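(* Let $K\subseteq L$ be convex bodies in $\mathbb{R}^d$ such that the origin is in the interior of $K\cap L$, and assume there is no nonempty finite collection of contact pairs $(v_1,p_1),\dots,(v_m,p_m)$ of $K$ and $L$ together with positive weights $\alpha_1,\dots,\alpha_m$ satisfying \[ \sum_{i=1}^m\alpha_i\,p_i\otimes v_i=\sum_{i=1}^m\alpha_i\,v_i\otimes p_i. \] Then for some $\varepsilon>0$ there is a differentiable path $R_t$, $t\in(0,\varepsilon]$, of orthogonal transformations of $\mathbb{R}^d$ such that $R_tK\subset\operatorname{int}L$ for all $t\in(0,\varepsilon]$.
   Context: A convex body is a compact convex set with nonempty interior. The polar of $S$ is $S^\circ=\{p:\langle x,p\rangle\le1\ \forall x\in S\}$. For convex bodies $K\subseteq L$, a contact pair of $K$ and $L$ is a pair $(v,p)$ with $v\in\partial K\cap\partial L$, $p\in\partial K^\circ\cap\partial L^\circ$, $\langle p,v\rangle=1$. For vectors $p,v$, $p\otimes v$ is the operator $x\mapsto\langle v,x\rangle p$. *)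

(* Defs.v *)
(* MathComp-Analysis over an abstract R : realType.
   Points of R^d are row vectors 'rV[R]_d with the canonical (sup-norm)
   topology of MathComp-Analysis, which is the Euclidean topology. *)
From HB Require Import structures.
From mathcomp Require Import all_boot all_order all_algebra.
From mathcomp Require Import all_classical all_reals all_analysis.
Set Implicit Arguments. Unset Strict Implicit. Unset Printing Implicit Defensive.
Import Order.TTheory GRing.Theory Num.Theory.
Import numFieldNormedType.Exports.
Local Open Scope classical_set_scope.
Local Open Scope ring_scope.

Definition dotp {R : realType} {d : nat} (x y : 'rV[R]_d) : R :=
  \sum_(i < d) x ord0 i * y ord0 i.

Definition convex_setR {R : realType} {d : nat} (S : set 'rV[R]_d) : Prop :=
  forall x y (t : R), S x -> S y -> 0 <= t -> t <= 1 ->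
    S (t *: x + (1 - t) *: y).

Definition convex_body {R : realType} {d : nat} (S : set 'rV[R]_d) : Prop :=
  compact S /\ convex_setR S /\ interior S !=set0.

Definition polar {R : realType} {d : nat} (S : set 'rV[R]_d) : set 'rV[R]_d :=
  [set p | forall x, S x -> dotp x p <= 1].

Definition bdry {R : realType} {d : nat} (S : set 'rV[R]_d) : set 'rV[R]_d :=
  closure S `\` interior S.

Definition contact_pair {R : realType} {d : nat} (K L : set 'rV[R]_d)
  (v p : 'rV[R]_d) : Prop :=
  bdry K v /\ bdry L v /\ bdry (polar K) p /\ bdry (polar L) p /\ dotp p v = 1.

(* the operator p (x) v : x |-> <v,x> p, as a matrix acting on column vectors
   (x |-> M *m x^T), i.e. M = p^T v. *)
Definition tens {R : realType} {d : nat} (p v : 'rV[R]_d) : 'M[R]_d :=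
  p^T *m v.

Definition orthogonal_mx {R : realType} {d : nat} (Q : 'M[R]_d) : Prop :=
  Q *m Q^T = 1%:M.

(* Main.v *)
(** The matrices p (x) v - v (x) p, over all contact pairs, form a compact set
    whose convex hull is compact by Caratheodory's theorem.  By hypothesis the
    hull avoids 0, so it is strictly separated from 0: this gives a skew matrix
    W with <vW, p> < 0 for every contact pair (v, p).  The Cayley transform
    R_t = (1 - tW)^-1 (1 + tW) is an orthogonal path with
    <xR_t, p> = <x, p> + 2t<xW, p> + O(t^2), uniformly over K and the polar of L.
    There either <x, p> < 1, or (x, p) is a contact pair and <xW, p> < 0; by
    compactness max(1 - <x, p>, -<xW, p>) is bounded below by a positive
    constant.  Hence for small t > 0 every <xR_t, p> is less than 1, and by the
    bipolar theorem xR_t lies in the interior of L. *)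
Require Import Defs.
From HB Require Import structures.
From mathcomp Require Import all_boot all_order all_algebra.
From mathcomp Require Import all_classical all_reals all_analysis.
From mathcomp Require Import ring lra.
Import Order.TTheory GRing.Theory Num.Theory.
Import numFieldNormedType.Exports.
Local Open Scope classical_set_scope.
Local Open Scope ring_scope.

(** * Bilinearity and positivity of the inner product *)

Section InnerProduct.
Context {R : realType} {d : nat}.
Implicit Types (x y z : 'rV[R]_d) (A : 'M[R]_d).

Lemma dotpE x y : dotp x y = (x *m y^T) 0 0.
Proof. by rewrite mxE; apply: eq_bigr => i _; rewrite mxE. Qed.

Lemma dotpC x y : dotp x y = dotp y x.
Proof. by apply: eq_bigr => i _; rewrite mulrC. Qed.

Lemma dotpDl x y z : dotp (x + y) z = dotp x z + dotp y z.
Proof. by rewrite !dotpE mulmxDl mxE. Qed.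

Lemma dotpZl (a : R) x y : dotp (a *: x) y = a * dotp x y.
Proof. by rewrite !dotpE -scalemxAl mxE. Qed.

Lemma dotpNl x y : dotp (- x) y = - dotp x y.
Proof. by rewrite !dotpE mulNmx mxE. Qed.

Lemma dotpBl x y z : dotp (x - y) z = dotp x z - dotp y z.
Proof. by rewrite dotpDl dotpNl. Qed.

Lemma dotpDr x y z : dotp z (x + y) = dotp z x + dotp z y.
Proof. by rewrite dotpC dotpDl !(dotpC z). Qed.

Lemma dotpZr (a : R) x y : dotp y (a *: x) = a * dotp y x.
Proof. by rewrite dotpC dotpZl dotpC. Qed.

Lemma dotpBr x y z : dotp z (x - y) = dotp z x - dotp z y.
Proof. by rewrite dotpC dotpBl !(dotpC z). Qed.

Lemma dotp0 x : dotp x 0 = 0.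
Proof. by rewrite dotpE trmx0 mulmx0 mxE. Qed.

Lemma dotp_mulmx A x y : dotp (x *m A) y = dotp x (y *m A^T).
Proof. by rewrite !dotpE trmx_mul trmxK mulmxA. Qed.

Lemma dotp_ge0 x : 0 <= dotp x x.
Proof. by apply: sumr_ge0 => i _; rewrite -expr2 sqr_ge0. Qed.

Lemma dotp_eq0 x : (dotp x x == 0) = (x == 0).
Proof.
apply/eqP/eqP => [/eqP|->]; last exact: dotp0.
rewrite psumr_eq0 => [/allP x0|i _]; last by rewrite -expr2 sqr_ge0.
apply/rowP => i; rewrite mxE; apply/eqP.
by have := x0 i (mem_index_enum i); rewrite /= mulf_eq0 orbb.
Qed.

Lemma dotp_le_mean x y : dotp x y <= (dotp x x + dotp y y) / 2.
Proof. have := dotp_ge0 (x - y); rewrite !(dotpBl, dotpBr) (dotpC y x); lra. Qed.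

Lemma dotp_skew A x : A^T = - A -> dotp (x *m A) x = 0.
Proof.
move=> AN; have : dotp (x *m A) x = - dotp (x *m A) x.
  by rewrite {1}dotp_mulmx AN mulmxN dotpC dotpNl.
lra.
Qed.

End InnerProduct.

(** * Entrywise continuity of matrix-valued maps *)

Section Continuity.
Context {R : realType} {T : topologicalType}.

(** Entries lie in an arbitrary space [U] so that rows of vectors are covered too. *)
Lemma continuous_coord (U : topologicalType) m n i j (f : T -> 'M[U]_(m, n)) :
  continuous f -> continuous (fun t => f t i j).
Proof.
move=> cf t A fA; apply: (cf t (fun M => A (M i j))).
exists (fun k l => if (k == i) && (l == j) then A else setT).
  move=> k l; case: ifP => [/andP[/eqP-> /eqP->]|_] //.
  by apply: filterT.
by move=> M /(_ i j); rewrite !eqxx.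
Qed.

Lemma continuous_mxP m n (f : T -> 'M[R]_(m, n)) :
  continuous f <-> forall i j, continuous (fun t => f t i j).
Proof.
split=> [cf i j|cf t A [P /= fP PA]]; first exact: continuous_coord.
rewrite nbhs_filterE /=.
apply: (@filterS _ _ _ (fun s => forall ij : 'I_m * 'I_n, P ij.1 ij.2 (f s ij.1 ij.2))).
  by move=> s Ps; apply: PA => i j; exact: (Ps (i, j)).
by apply: filter_forall => -[i j]; exact: (cf i j t).
Qed.

Lemma continuous_sumr n (f : 'I_n -> T -> R) :
  (forall i, continuous (f i)) -> continuous (fun t => \sum_i f i t).
Proof.
by move=> cf; apply: continuous_big => // x; exact: (@add_continuous R^o).
Qed.

Lemma continuous_dotp n (f g : T -> 'rV[R]_n) :
  continuous f -> continuous g -> continuous (fun t => dotp (f t) (g t)).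
Proof.
move=> /continuous_mxP cf /continuous_mxP cg; apply: continuous_sumr => i t.
by apply: continuousM; [exact: cf|exact: cg].
Qed.

Lemma continuous_mulmxl m n p (A : 'M[R]_(n, p)) (f : T -> 'M[R]_(m, n)) :
  continuous f -> continuous (fun t => f t *m A).
Proof.
move=> /continuous_mxP cf; apply/continuous_mxP => i j.
rewrite (_ : (fun _ => _) = fun t => \sum_k f t i k * A k j); last first.
  by apply/funext => t; rewrite mxE.
by apply: continuous_sumr => k t; apply: continuousM; [exact: cf|exact: cst_continuous].
Qed.

End Continuity.

(** * Points of least norm *)

Section Nearest.
Context {R : realType} {n : nat}.

(** Moving from [w] towards [u] cannot decrease the norm. The condition concerns a single segment
    because the lemma is later applied to hulls on a fixed number of points. *)
Lemma nearest_to_origin (A : set 'rV[R]_n) : compact A -> A !=set0 ->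
  exists2 w, A w & forall u,
    (forall l : R, 0 <= l -> l <= 1 -> A (w + l *: (u - w))) ->
    dotp w w <= dotp w u.
Proof.
move=> cA A0.
have [|w /set_mem Aw wmin] := @compact_EVT_min _ R (fun x => dotp x x) A A0 cA.
  by apply: continuous_subspaceT; apply: continuous_dotp => x; exact: cvg_id.
exists w => // u Au; rewrite -subr_ge0 -dotpBr; move: (u - w) Au => D Au; set c := dotp w D.
rewrite leNgt; apply/negP => c0.
set e := dotp D D.
have e0 : 0 <= e := dotp_ge0 _.
(* This [l] lies in (0, 1] and changes the squared norm by [l * c * (1 + l)], which is negative. *)
pose l := - c / (e - c).
have ec : 0 < e - c by lra.
have l0 : 0 < l by rewrite divr_gt0 // oppr_gt0.
have l1 : l <= 1 by rewrite ler_pdivrMr //; lra.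
have := wmin _ (mem_set (Au l (ltW l0) l1)).
rewrite !(dotpDl, dotpDr, dotpZl, dotpZr) (dotpC D w) -/c -/e.
have le : l * (e - c) = - c by rewrite divfK // gt_eqF.
nra.
Qed.

End Nearest.

(** * Convex hulls, Caratheodory's theorem and separation *)

Section Hull.
Context {R : realType} {N : nat}.

(** The number of points is fixed for the sake of compactness; they form a row of vectors so that
    [rV_compact] applies. *)
Definition hull n (S : set 'rV[R]_N) : set 'rV[R]_N :=
  [set z | exists (a : 'rV[R]_n) (v : 'rV['rV[R]_N]_n),
    [/\ forall i, 0 <= a 0 i, \sum_i a 0 i = 1, forall i, S (v 0 i)
      & z = \sum_i a 0 i *: v 0 i]].

(** The hull is the continuous image of the simplex [D] times the product [V] of [n] copies of
    [S]. *)
Lemma hull_compact n (S : set 'rV[R]_N) : compact S -> compact (hull n S).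
Proof.
move=> cS.
pose D : set 'rV[R]_n := [set a : 'rV[R]_n | forall i, `[0, 1]%classic (a 0 i)]
  `&` (fun a : 'rV[R]_n => \sum_i a 0 i) @^-1` [set 1].
have cD : compact D.
  apply: compact_closedI.
    apply: (@rV_compact R n (fun=> `[0, 1]%classic)) => i.
    exact: segment_compact.
  apply: preimage_closed; last exact: (@closed_eq R 1).
  by move=> a _; apply: continuous_sumr => i; exact: coord_continuous.
pose V : set 'rV['rV[R]_N]_n := [set v : 'rV['rV[R]_N]_n | forall i, S (v 0 i)].
have cV : compact V.
  exact: (@rV_compact _ n (fun=> S)).
pose F (q : 'rV[R]_n * 'rV['rV[R]_N]_n) : 'rV[R]_N :=
  \sum_i q.1 0 i *: q.2 0 i.
rewrite (_ : hull n S = F @` (D `*` V)).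
  apply: continuous_compact; last exact: compact_setX.
  apply: continuous_subspaceT; apply/continuous_mxP => i j.
  rewrite (_ : (fun _ => _) = fun t : 'rV[R]_n * 'rV['rV[R]_N]_n =>
    \sum_k t.1 0 k * t.2 0 k i j); last first.
    by apply/funext => t; rewrite summxE; apply: eq_bigr => k _; rewrite mxE.
  apply: continuous_sumr => k t; apply: continuousM.
    apply: (@continuous_coord _ _ 1 n 0 k fst) => q; exact: cvg_fst.
  apply: (@continuous_coord _ _ 1 N i j
    (fun q : 'rV[R]_n * 'rV['rV[R]_N]_n => q.2 0 k)).
  apply: (@continuous_coord _ _ 1 n 0 k snd) => q; exact: cvg_snd.
apply/seteqP; split=> [z [a [v [a0 a1 vS ->]]]|_ [[a v] [[/= a01 a1] vS] <-]].
  exists (a, v) => //; split => //=; split => //= i.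
  rewrite in_itv /= a0 -a1 (bigD1 i) //= lerDl sumr_ge0 // => j _; exact: a0.
exists a, v; split => // i; by have := a01 i; rewrite /= in_itv /= => /andP[].
Qed.

(* Caratheodory's theorem: among n + 1 > N + 1 points there is an affine
   dependence, which is subtracted until some weight vanishes. *)
Lemma hull_shrink n (S : set 'rV[R]_N) : (N < n)%N -> hull n.+1 S `<=` hull n S.
Proof.
move=> Nn z [a [v [a0 a1 vS ->]]].
(* A left kernel vector of the matrix with rows (v_i, 1) is an affine dependence; it exists because
   n + 1 > N + 1. *)
pose U : 'M[R]_(n.+1, N + 1) := \matrix_i row_mx (v 0 i) 1%:M.
have [mu muU mu_neq0] : exists2 mu : 'rV[R]_n.+1, mu *m U = 0 & mu != 0.
  have : kermx U != 0.
    rewrite kermx_eq0 /row_free neq_ltn; apply/orP; left.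
    by rewrite (leq_ltn_trans (rank_leq_col U)) // addn1 ltnS.
  by case/rowV0Pn => mu /sub_kermxP; exists mu.
have muE : mu *m U = row_mx (\sum_i mu 0 i *: v 0 i) (\sum_i mu 0 i)%:M.
  apply/rowP => j; case: (split_ordP j) => k ->{j}.
    rewrite row_mxEl mxE summxE; apply: eq_bigr => i _.
    by rewrite [U _ _]mxE row_mxEl [RHS]mxE.
  rewrite row_mxEr !mxE ord1 eqxx mulr1n; apply: eq_bigr => i _.
  by rewrite [U _ _]mxE row_mxEr mxE eqxx mulr1.
have [mu_v mu1] : \sum_i mu 0 i *: v 0 i = 0 /\ \sum_i mu 0 i = 0.
  have : row_mx (\sum_i mu 0 i *: v 0 i) (\sum_i mu 0 i)%:M =
         row_mx 0 (0 : 'M[R]_1) by rewrite -muE muU row_mx0.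
  by move/eq_row_mx => [-> /rowP/(_ 0)]; rewrite !mxE eqxx mulr1n.
have [i1 mu_i1] : exists i, 0 < mu 0 i.
  apply: contrapT => /forallNP mu_npos.
  have mu_le0 i : mu 0 i <= 0 by rewrite leNgt; apply/negP.
  case/negP: mu_neq0; apply/eqP/rowP => i; rewrite mxE; apply/eqP.
  rewrite -oppr_eq0; have : \sum_i - mu 0 i == 0 by rewrite sumrN mu1 oppr0.
  rewrite psumr_eq0 => [/allP/(_ i (mem_index_enum i)) //|k _].
  by rewrite oppr_ge0.
(* The least ratio is the largest multiple of [mu] whose subtraction keeps all weights nonnegative;
   the weight at [i0] becomes 0. *)
pose i0 := [arg min_(i < i1 | 0 < mu 0 i) (a 0 i / mu 0 i)]%O.
have [mu_i0 i0_min] : 0 < mu 0 i0 /\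
    forall i, 0 < mu 0 i -> a 0 i0 / mu 0 i0 <= a 0 i / mu 0 i.
  by rewrite /i0; case: arg_minP.
pose c := a 0 i0 / mu 0 i0.
have c0 : 0 <= c by rewrite divr_ge0 // ltW.
pose b i := a 0 i - c * mu 0 i.
have b_i0 : b i0 = 0 by rewrite /b /c divfK ?subrr // gt_eqF.
have b0 i : 0 <= b i.
  rewrite subr_ge0; have [mu_i|mu_i] := ltP 0 (mu 0 i).
    by rewrite -ler_pdivlMr // i0_min.
  by rewrite (le_trans _ (a0 i)) // mulr_ge0_le0.
exists (\row_j b (lift i0 j)), (\row_j v 0 (lift i0 j)); split.
- by move=> j; rewrite mxE.
- rewrite (eq_bigr (fun j => b (lift i0 j))) => [|j _]; last by rewrite mxE.
  transitivity (\sum_i b i); last by rewrite sumrB -mulr_sumr mu1 mulr0 subr0.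
  by rewrite [RHS](bigD1_ord i0) //= b_i0 add0r.
- by move=> j; rewrite mxE.
- rewrite [RHS](eq_bigr (fun j => b (lift i0 j) *: v 0 (lift i0 j))); last first.
    by move=> j _; rewrite !mxE.
  transitivity (\sum_i b i *: v 0 i); last first.
    by rewrite (bigD1_ord i0) //= b_i0 scale0r add0r.
  under [RHS]eq_bigr do rewrite scalerBl -scalerA.
  by rewrite sumrB -scaler_sumr mu_v scaler0 subr0.
Qed.

End Hull.

(** Take [w] in the hull nearest to 0. The segment from [w] to [s] uses N + 2 points, so
    [hull_shrink] keeps it in the hull, and <w, s> >= <w, w> > 0. *)
Lemma strict_separation (R : realType) (N : nat) (S : set 'rV[R]_N) :
  compact S -> ~ hull N.+1 S 0 -> exists w, forall s, S s -> 0 < dotp w s.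
Proof.
move=> cS S0; have [[s0 Ss0]|/forallNP Se] := pselect (S !=set0); last first.
  by exists 0 => s /Se.
have hull_s0 : hull N.+1 S !=set0.
  exists (\sum_(i < N.+1) N.+1%:R^-1 *: s0), (const_mx N.+1%:R^-1), (const_mx s0).
  split=> [i||i|]; rewrite ?mxE ?invr_ge0 //.
    under eq_bigr do rewrite mxE.
    by rewrite sumr_const card_ord -[LHS]mulr_natr mulVf // pnatr_eq0.
  by apply: eq_bigr => i _; rewrite !mxE.
have [w hw wmin] := @nearest_to_origin _ _ _ (@hull_compact _ _ N.+1 _ cS) hull_s0.
exists w => s Ss; have ww : 0 < dotp w w.
  rewrite lt_def dotp_ge0 dotp_eq0 andbT; apply/eqP => w0.
  by apply: S0; rewrite -w0.
apply: (lt_le_trans ww); apply: wmin => l l0 l1.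
apply: hull_shrink => //; case: hw => a [v [a0 a1 vS wE]].
(* The point [s] is put first with weight [l]; the old weights are scaled by [1 - l]. *)
exists (\row_i if unlift ord0 i is Some j then (1 - l) * a 0 j else l),
  (\row_i if unlift ord0 i is Some j then v 0 j else s); split.
- move=> i; rewrite mxE; case: unliftP => // j _.
  by rewrite mulr_ge0 // subr_ge0.
- rewrite big_ord_recl mxE unlift_none.
  under eq_bigr do rewrite mxE liftK.
  by rewrite -mulr_sumr a1 mulr1; ring.
- by move=> i; rewrite mxE; case: unliftP.
- rewrite big_ord_recl !mxE unlift_none.
  under [X in _ = _ + X]eq_bigr do rewrite !mxE liftK -scalerA.
  rewrite -scaler_sumr -wE scalerBr scalerBl scale1r addrCA; congr (_ + _).
Qed.

(** * Polars and the bipolar theorem *)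

Section Polar.
Context {R : realType} {d : nat}.
Implicit Types (L : set 'rV[R]_d) (x p z : 'rV[R]_d).

Lemma closed_dotp_le x (c : R) : closed [set p : 'rV[R]_d | dotp x p <= c].
Proof.
apply: (@preimage_closed _ _ (dotp x) [set y | y <= c]); last exact: closed_le.
move=> p _; apply: continuous_dotp => q; [exact: cst_continuous|exact: cvg_id].
Qed.

Lemma polar_compact L : nbhs (0 : 'rV[R]_d) L -> compact (polar L).
Proof.
move=> /nbhs_ballP[r /= r0 rL].
have cB : compact [set p : 'rV[R]_d | forall i, `[- (2 / r), 2 / r]%classic (p 0 i)].
  by apply: (@rV_compact R d (fun=> `[_, _]%classic)) => i; exact: segment_compact.
apply: subclosed_compact cB _.
  rewrite (_ : polar L = \bigcap_(x in L) [set p | dotp x p <= 1]).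
    by apply: closed_bigI => x _; exact: closed_dotp_le.
  by apply/seteqP; split.
move=> p Lp i.
(* Testing [p] on a multiple of a basis vector inside the ball; e = 1 and e = -1 bound the
   coordinate by 2 / r in absolute value. *)
have coordL (e : R) : `|e| <= 1 -> (r / 2) * (e * p 0 i) <= 1.
  move=> e1; have := Lp ((r / 2 * e) *: delta_mx 0 i).
  rewrite dotpZl mulrA /dotp (bigD1 i) //= big1 => [|j ji]; last first.
    by rewrite mxE (negbTE ji) andbF mul0r.
  rewrite mxE !eqxx mul1r addr0; apply; apply: rL.
  split=> // k j; rewrite /ball /= !mxE sub0r normrN normrM normr_nat.
  have r2 : 0 < r / 2 by rewrite divr_gt0.
  apply: (@le_lt_trans _ _ (r / 2)); last lra.
  rewrite normrM (gtr0_norm r2) -[leRHS]mulr1 -mulrA ler_pM2l //.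
  by case: (_ && _); rewrite ?mulr1 ?mulr0.
have c2 (y : R) : r / 2 * y <= 1 -> y <= 2 / r.
  by rewrite -ler_pdivlMl ?divr_gt0 // mulr1 invf_div.
rewrite /= in_itv /= lerNl !c2 //.
  by have := coordL 1; rewrite normr1 mul1r; apply.
by have := coordL (-1); rewrite normrN1 mulN1r; apply.
Qed.

(** If [x0] is the point of [L] nearest to [z] and w = x0 - z, then <w, x - z> >= <w, w> on [L]; a
    multiple of [w] is the separating [p]. *)
Lemma polar_separation L z : compact L -> convex_setR L -> L 0 -> ~ L z ->
  exists2 p, polar L p & 1 < dotp z p.
Proof.
move=> cL conv L0 Lz.
have cT : compact ((fun x => x - z) @` L).
  apply: continuous_compact cL; apply/continuous_subspaceT/continuous_mxP => i j.
  rewrite (_ : (fun _ => _) = fun x : 'rV[R]_d => x i j + (- z) i j); last first.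
    by apply/funext => x; rewrite mxE; reflexivity.
  move=> x; apply: (@continuousD R R^o _ (fun x : 'rV[R]_d => x i j) (cst ((- z) i j))).
    by move: x; exact: coord_continuous.
  exact: cst_continuous.
have [|_ [x0 Lx0 <-] wmin] := nearest_to_origin _ cT; first by exists (0 - z), 0.
set w := x0 - z in wmin.
have ww : 0 < dotp w w.
  rewrite lt_def dotp_ge0 dotp_eq0 andbT subr_eq0; apply/eqP => x0z.
  by apply: Lz; rewrite -x0z.
have wL x : L x -> dotp w w <= dotp w (x - z).
  move=> Lx; apply: wmin => l l0 l1; exists (l *: x + (1 - l) *: x0).
    exact: conv.
  by apply/rowP => i; rewrite /w !mxE; ring.
(* On [L], <w, x> >= - c + <w, w> / 2, while <w, z> = - c - <w, w> / 2, so dividing by - c places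
   the level 1 between them. *)
pose c := - dotp w z - dotp w w / 2.
have c0 : 0 < c.
  have := wL _ L0; rewrite dotpBr dotp0 /c; lra.
exists (- c^-1 *: w).
  move=> x /wL; rewrite dotpBr dotpZr (dotpC x) mulNr -mulrN ler_pdivrMl // /c.
  lra.
rewrite dotpZr (dotpC z) mulNr -mulrN ltr_pdivlMl // /c; lra.
Qed.

(** The ball of radius (1 - c) r about c z consists of points c z + (1 - c) u with u in the ball of
    radius r about 0. *)
Lemma interior_shrink L z (c : R) : convex_setR L -> nbhs (0 : 'rV[R]_d) L -> L z ->
  0 <= c -> c < 1 -> nbhs (c *: z) L.
Proof.
move=> conv /nbhs_ballP[r /= r0 rL] Lz c0 c1.
apply/nbhs_ballP; exists ((1 - c) * r) => /=; first by rewrite mulr_gt0 // subr_gt0.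
move=> y; rewrite mx_norm_ball /ball_ /= => yB.
have c10 : 1 - c != 0 by rewrite subr_eq0 gt_eqF.
rewrite (_ : y = c *: z + (1 - c) *: ((1 - c)^-1 *: (y - c *: z))); last first.
  by rewrite scalerA divff // scale1r addrC subrK.
apply: conv => //; last exact: ltW.
apply: rL; rewrite mx_norm_ball /ball_ /= sub0r normrN normrZ distrC.
by rewrite ger0_norm ?invr_ge0 ?subr_ge0 ?(ltW c1) // ltr_pdivrMl // subr_gt0.
Qed.

(** The maximum of <z, .> on the compact polar is below some c < 1. By separation z / c lies in [L],
    so shrinking it by c gives an interior point. *)
Lemma polar_interior L z : compact L -> convex_setR L -> nbhs (0 : 'rV[R]_d) L ->
  (forall p, polar L p -> dotp z p < 1) -> nbhs z L.
Proof.
move=> cL conv L0 zp.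
have polar0 : polar L 0 by move=> x _; rewrite dotp0.
have [|||p /set_mem Lp pmax] := @compact_EVT_max _ R (dotp z) (polar L).
- by exists 0.
- exact: polar_compact.
- apply: continuous_subspaceT; apply: continuous_dotp => q.
  + exact: cst_continuous.
  + exact: cvg_id.
have m0 : 0 <= dotp z p by rewrite -(dotp0 z); apply: pmax; exact/mem_set.
have m1 := zp _ Lp.
pose c := (dotp z p + 1) / 2.
have c0 : 0 < c by rewrite /c; lra.
rewrite (_ : z = c *: (c^-1 *: z)); last by rewrite scalerA divff ?scale1r ?gt_eqF.
apply: interior_shrink => //; [|exact: ltW|by rewrite /c; lra].
apply: contrapT => /(polar_separation _ _ cL conv (nbhs_singleton L0))[q Lq].
rewrite dotpZl ltr_pdivlMl // mulr1; have := pmax _ (mem_set Lq); rewrite /c; lra.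
Qed.

(** The points (1 + e) z with e > 0 violate the bound, so no neighbourhood of [z] lies in [A]. *)
Lemma bdry_support (A : set 'rV[R]_d) z q : (forall x, A x -> dotp x q <= 1) ->
  A z -> dotp z q = 1 -> bdry A z.
Proof.
move=> Aq Az zq; split; first exact: subset_closure.
move=> Azint.
have : nbhs (1 : R) ((fun l : R => l *: z) @^-1` A).
  have cz : continuous (fun l : R => l *: z).
    apply/continuous_mxP => i j.
    rewrite (_ : (fun _ => _) = fun l : R => l * z i j); last first.
      by apply/funext => l; rewrite mxE.
    by move=> l; apply: continuousM; [exact: cvg_id|exact: cvg_cst].
  by apply: cz; rewrite scale1r.
move=> /nbhs_ballP[r /= r0 rA].
have := Aq ((1 + r / 2) *: z); rewrite dotpZl zq mulr1.
suff : A ((1 + r / 2) *: z) by move=> h /(_ h); lra.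
apply: rA; rewrite /ball /= opprD addNKr normrN gtr0_norm; lra.
Qed.

End Polar.

(** * The Cayley transform of a skew matrix *)

Section Cayley.
Context {R : realType} {d : nat} (W : 'M[R]_d) (W_skew : W^T = - W).

Definition cayley (t : R) : 'M[R]_d :=
  invmx (1%:M - t *: W) *m (1%:M + t *: W).

(** If x = t xW, then <x, x> = t <xW, x> = 0 by skewness. *)
Let minusW t : 1%:M - t *: W \in unitmx.
Proof.
rewrite -row_free_unit; apply: inj_row_free => x.
rewrite mulmxBr mulmx1 -scalemxAr => /eqP; rewrite subr_eq0 => /eqP xE.
by apply/eqP; rewrite -dotp_eq0 {1}xE dotpZl dotp_skew // mulr0.
Qed.

(** The factors 1 - tW and 1 + tW are transposes of each other and commute. *)
Lemma cayley_orthogonal t : orthogonal_mx (cayley t).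
Proof.
have trD : (1%:M + t *: W)^T = 1%:M - t *: W.
  by rewrite linearD /= linearZ /= trmx1 W_skew scalerN.
have trB : (1%:M - t *: W)^T = 1%:M + t *: W by rewrite -trD trmxK.
rewrite /orthogonal_mx /cayley trmx_mul trmx_inv trD trB mulmxA -(mulmxA (invmx _)).
have -> : (1%:M + t *: W) *m (1%:M - t *: W) = (1%:M - t *: W) *m (1%:M + t *: W).
  rewrite [LHS]mulmxDl [RHS]mulmxBl !mul1mx mulmxBr mulmxDr !mulmx1.
  by rewrite opprD !addrA subrK addrK.
rewrite mulmxA mulVmx // mul1mx mulmxV //.
by rewrite -trB unitmx_tr.
Qed.

(** By the adjugate formula each entry is a quotient of polynomials in t, with denominator det(1 -
    tW), which never vanishes. *)
Lemma cayley_derivable t : derivable cayley t 1.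
Proof.
pose V : 'M[{poly R}]_d := 'X *: map_mx polyC W.
have evalV s : map_mx (horner_eval s) V = s *: W.
  by apply/matrixP => i j; rewrite !mxE /horner_eval !hornerE.
have evalB s : map_mx (horner_eval s) (1%:M - V) = 1%:M - s *: W.
  by rewrite map_mxB map_mx1 evalV.
apply/derivable_mxP => i j.
pose q := \det (1%:M - V); pose r := (\adj (1%:M - V) *m (1%:M + V)) i j.
have qE s : q.[s] = \det (1%:M - s *: W).
  by rewrite -evalB det_map_mx.
have rE s : r.[s] = (\adj (1%:M - s *: W) *m (1%:M + s *: W)) i j.
  rewrite -evalB -map_mx_adj -evalV -(map_mx1 (horner_eval s)) -map_mxD.
  by rewrite -map_mxM mxE.
rewrite (_ : (fun _ => _) = (fun s => (q.[s])^-1) * horner r); last first.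
  apply/funext => s; rewrite /cayley /invmx minusW -scalemxAl mxE.
  by rewrite -rE -qE.
apply: derivableM; last exact: derivable_horner.
apply: derivableV; last exact: derivable_horner.
by rewrite qE; have := minusW t; rewrite unitmxE unitfE.
Qed.

(* The point y = x (1 - t W)^-1 satisfies |y| <= |x|, which makes the
   second-order error uniform in t. *)
Lemma cayley_expansion t (x p : 'rV[R]_d) :
  dotp (x *m cayley t) p <= dotp x p + 2 * t * dotp (x *m W) p
    + t ^+ 2 * (dotp x x + dotp (p *m W *m W) (p *m W *m W)).
Proof.
pose y := x *m invmx (1%:M - t *: W).
have xE : x = y - t *: (y *m W).
  by rewrite scalemxAr -{1}(mulmx1 y) -mulmxBr mulmxKV.
have yx : dotp y y <= dotp x x.
  rewrite xE !(dotpBl, dotpBr, dotpZl, dotpZr) (dotpC y) dotp_skew //.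
  by have := dotp_ge0 (t *: (y *m W)); rewrite dotpZl dotpZr; lra.
(* Here xR_t = y + t yW = x + 2t yW, and yW = xW + t yW^2. *)
have -> : x *m cayley t = x + (2 * t) *: (x *m W) + (2 * t ^+ 2) *: (y *m W *m W).
  rewrite /cayley mulmxA -/y mulmxDr mulmx1 -scalemxAr xE mulmxBl -scalemxAl.
  by apply/rowP => i; rewrite !mxE; ring.
rewrite !(dotpDl, dotpZl) lerD2l -mulrA mulrCA ler_wpM2l ?sqr_ge0 //.
(* W^2 is symmetric, so it moves onto [p]; then [y] enters only through its norm. *)
have -> : dotp (y *m W *m W) p = dotp y (p *m W *m W).
  by rewrite [LHS]dotp_mulmx [LHS]dotp_mulmx W_skew !mulmxN mulNmx opprK.
by have := dotp_le_mean y (p *m W *m W); lra.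
Qed.

End Cayley.

(** * Contact pairs and the direction of rotation *)

Lemma contact_pair_polar (R : realType) (d : nat) (K L : set 'rV[R]_d) x p :
  K `<=` L -> K x -> polar L p -> dotp x p = 1 -> contact_pair K L x p.
Proof.
move=> KL Kx Lp xp.
(* Now [p] supports [K] and [L] at [x], and [x] supports both polars at [p]. *)
have Kp : polar K p by move=> z /KL; exact: Lp.
have px : dotp p x = 1 by rewrite dotpC.
split; [|split; [|split; [|split]]] => //.
- exact: (bdry_support _ _ p).
- by apply: (bdry_support _ _ p) => //; exact: KL.
- by apply: (bdry_support _ _ x) => // q /(_ _ Kx); rewrite dotpC.
- by apply: (bdry_support _ _ x) => // q /(_ _ (KL _ Kx)); rewrite dotpC.
Qed.

Lemma skew_direction (R : realType) (d : nat) (K L : set 'rV[R]_d) :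
  compact K -> K `<=` L -> nbhs (0 : 'rV[R]_d) L ->
  ~ (exists (m : nat) (v p : 'I_m -> 'rV[R]_d) (alpha : 'I_m -> R),
        (0 < m)%N /\
        (forall i, contact_pair K L (v i) (p i)) /\
        (forall i, 0 < alpha i) /\
        \sum_(i < m) alpha i *: tens (p i) (v i) =
        \sum_(i < m) alpha i *: tens (v i) (p i)) ->
  exists2 W : 'M[R]_d, W^T = - W &
    forall x p, K x -> polar L p -> dotp x p = 1 -> dotp (x *m W) p < 0.
Proof.
move=> cK KL L0 nocontact.
(* Written without boundaries, this set is visibly compact; its elements are contact pairs by
   [contact_pair_polar]. *)
pose C : set ('rV[R]_d * 'rV[R]_d) :=
  (K `*` polar L) `&` (fun q => dotp q.1 q.2) @^-1` [set 1].
have cC : compact C.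
  apply: compact_closedI; first exact: compact_setX cK (polar_compact _ L0).
  apply: preimage_closed; last exact: (@closed_eq R 1).
  by move=> q _; apply: continuous_dotp => {}q; [exact: cvg_fst|exact: cvg_snd].
pose phi (q : 'rV[R]_d * 'rV[R]_d) := mxvec (tens q.2 q.1 - tens q.1 q.2).
have cS : compact (phi @` C).
  apply: continuous_compact cC; apply/continuous_subspaceT/continuous_mxP => i j.
  rewrite ord1; case/mxvec_indexP: j => k l.
  rewrite (_ : (fun _ => _) = fun q : 'rV[R]_d * 'rV[R]_d =>
    q.2 0 k * q.1 0 l - q.1 0 k * q.2 0 l); last first.
    by apply/funext => q; rewrite mxvecE !mxE !big_ord1 !mxE.
  have c1 m : continuous (fun q : 'rV[R]_d * 'rV[R]_d => q.1 0 m).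
    by apply: (@continuous_coord _ _ 1 d 0 m fst) => q; exact: cvg_fst.
  have c2 m : continuous (fun q : 'rV[R]_d * 'rV[R]_d => q.2 0 m).
    by apply: (@continuous_coord _ _ 1 d 0 m snd) => q; exact: cvg_snd.
  move=> q; apply: (@continuousB R R^o _
    (fun q : 'rV[R]_d * 'rV[R]_d => q.2 0 k * q.1 0 l)
    (fun q : 'rV[R]_d * 'rV[R]_d => q.1 0 k * q.2 0 l)).
    by apply: continuousM; [exact: c2|exact: c1].
  by apply: continuousM; [exact: c1|exact: c2].
have [|w wpos] := strict_separation _ _ _ cS.
  case=> a [s [a0 a1 sS s0]]; apply: nocontact.
  have [vp vpE] : {vp : 'I_(d * d).+1 -> 'rV[R]_d * 'rV[R]_d &
      forall i, C (vp i) /\ phi (vp i) = s 0 i}.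
    apply: (@choice _ _ (fun i q => C q /\ phi q = s 0 i)) => i.
    by have [q] := sS i; exists q.
  (* Zero weights are discarded, as the hypothesis speaks of positive ones; some weight remains
     because they sum to 1. *)
  pose A := [pred i | 0 < a 0 i].
  exists #|A|, (fun i => (vp (enum_val i)).1), (fun i => (vp (enum_val i)).2),
    (fun i => a 0 (enum_val i)); split; [|split; [|split]].
  - rewrite lt0n; apply/eqP => /card0_eq A0.
    move: a1; rewrite big1 => [/esym/eqP|i _]; first by rewrite oner_eq0.
    by apply/eqP; rewrite eq_le a0 andbT leNgt; have := A0 i; rewrite !inE => ->.
  - move=> i; have [[[? ?] ?] _] := vpE (enum_val i).
    exact: contact_pair_polar.
  - by move=> i; have := enum_valP i.
  - apply/eqP; rewrite -subr_eq0 -sumrB; apply/eqP.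
    under eq_bigr do rewrite -scalerBr.
    apply: (can_inj mxvecK); rewrite linear0 [RHS]s0.
    rewrite -(@big_enum_val _ _ _ _ A (fun i =>
      a 0 i *: (tens (vp i).2 (vp i).1 - tens (vp i).1 (vp i).2))).
    rewrite linear_sum big_mkcond /=; apply: eq_bigr => i _.
    have [_ <-] := vpE i; rewrite linearZ /= inE; case: ifP => // /negbT.
    rewrite -leNgt => ai; have -> : a 0 i = 0 by apply/eqP; rewrite eq_le ai a0.
    by rewrite scale0r.
pose M : 'M[R]_d := vec_mx w.
(* For W = M - M^T, the pairing of [w] with [phi (x, p)] is <pM, x> - <xM, p> = - <xW, p>. *)
exists (M - M^T).
  by rewrite linearB /= trmxK opprB.
move=> x p Kx Lp xp.
have := wpos (phi (x, p)) (ex_intro2 _ _ (x, p) (conj (conj Kx Lp) xp) erefl).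
rewrite dotpC /phi /= linearB /= dotpBl !dotpE -(vec_mxK w) !mxvec_dotmul -/M -!dotpE.
rewrite mulmxBr dotpBl [dotp (x *m M^T) p]dotp_mulmx trmxK (dotpC x) => ?; lra.
Qed.

(** * The uniform estimate along the path *)

Theorem mainTheorem6 (R : realType) (d : nat) (K L : set 'rV[R]_d) :
  convex_body K -> convex_body L -> K `<=` L ->
  interior (K `&` L) 0 ->
  ~ (exists (m : nat) (v p : 'I_m -> 'rV[R]_d) (alpha : 'I_m -> R),
        (0 < m)%N /\
        (forall i, contact_pair K L (v i) (p i)) /\
        (forall i, 0 < alpha i) /\
        \sum_(i < m) alpha i *: tens (p i) (v i) =
        \sum_(i < m) alpha i *: tens (v i) (p i)) ->
  exists (eps : R) (Rt : R -> 'M[R]_d), 0 < eps /\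
    forall t, 0 < t <= eps ->
      orthogonal_mx (Rt t) /\ derivable Rt t 1 /\
      (forall x, K x -> interior L (x *m Rt t)).
Proof.
move=> [cK _] [cL [convL _]] KL KL0 nocontact.
have L0 : nbhs (0 : 'rV[R]_d) L by apply: filterS KL0 => x [].
have [K0 _] : (K `&` L) 0 by exact: nbhs_singleton.
have [W W_skew W_neg] := skew_direction _ _ _ _ cK KL L0 nocontact.
pose KP := K `*` polar L.
have cKP : compact KP by exact: compact_setX cK (polar_compact _ L0).
have KP0 : KP !=set0 by exists (0, 0); split=> // x _; rewrite dotp0.
have c1 : continuous (fst : 'rV[R]_d * 'rV[R]_d -> 'rV[R]_d).
  by move=> q; exact: cvg_fst.
have c2 : continuous (snd : 'rV[R]_d * 'rV[R]_d -> 'rV[R]_d).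
  by move=> q; exact: cvg_snd.
pose gap (q : 'rV[R]_d * 'rV[R]_d) : R^o := 1 - dotp q.1 q.2.
pose speed (q : 'rV[R]_d * 'rV[R]_d) : R^o := - dotp (q.1 *m W) q.2.
have [|[x0 p0] /set_mem[/= Kx0 Lp0] hmin] :=
    @compact_EVT_min _ R (gap \max speed) KP KP0 cKP.
  apply: continuous_subspaceT => q; apply: continuous_max.
    apply: (@continuousB R R^o _ (cst 1)); first exact: cst_continuous.
    by move: q; exact: continuous_dotp.
  apply: (@continuousN R R^o).
  move: q; apply: continuous_dotp => //.
  exact: continuous_mulmxl.
set del : R := (gap \max speed) (x0, p0) in hmin.
have del0 : 0 < del.
  rewrite /del /= lt_max /gap /speed /= oppr_gt0 subr_gt0.
  have := Lp0 _ (KL _ Kx0); rewrite le_eqVlt => /orP[/eqP xp|->//].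
  by rewrite W_neg // orbT.
(* The first bracket is the second-order coefficient of [cayley_expansion]; the second bounds 2 <xW,
   p>. *)
pose B (q : 'rV[R]_d * 'rV[R]_d) : R :=
  (dotp q.1 q.1 + dotp (q.2 *m W *m W) (q.2 *m W *m W)) +
  (dotp (q.1 *m W) (q.1 *m W) + dotp q.2 q.2).
have cadd (f g : 'rV[R]_d * 'rV[R]_d -> R) : continuous f -> continuous g ->
    continuous (fun q => f q + g q).
  by move=> cf cg q; apply: (@continuousD R R^o); [exact: cf|exact: cg].
have [|[x1 p1] _ Bmax] := @compact_EVT_max _ R B KP KP0 cKP.
  apply: continuous_subspaceT.
  by apply: (cadd _ _ _ _); apply: (cadd _ _ _ _); apply: continuous_dotp => //;
    repeat apply: continuous_mulmxl.
set M := B (x1, p1) in Bmax.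
have M0 : 0 <= M by rewrite !addr_ge0 ?dotp_ge0.
have D0 : 0 < 2 * M + del + 1 by lra.
(* This choice gives both t <= 1 and 2tM < del. *)
exists (del / (2 * M + del + 1)), (cayley W); split; first by rewrite divr_gt0.
move=> t /andP[t0]; rewrite ler_pdivlMr // => t_eps.
split; [exact: cayley_orthogonal|split; [exact: cayley_derivable|move=> x Kx]].
apply: polar_interior => // p Lp.
have KPxp : (x, p) \in KP by apply/mem_set; split.
have := cayley_expansion W W_skew t x p.
have := Bmax _ KPxp; rewrite {1}/B /= => BM expand.
have hdel : (del <= 1 - dotp x p) || (del <= - dotp (x *m W) p).
  by have := hmin _ KPxp; rewrite /= le_max.
have xp1 : dotp x p <= 1 by apply/Lp/KL.
have := dotp_le_mean (x *m W) p.
have := dotp_ge0 x; have := dotp_ge0 p; have := dotp_ge0 (x *m W).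
have := dotp_ge0 (p *m W *m W).
move: (dotp x x) (dotp p p) (dotp (p *m W *m W) _) (dotp (x *m W) (x *m W)) BM expand.
move=> X P Y Z BM expand Y0 Z0 P0 X0 speed_le.
apply: (le_lt_trans expand).
have tXY : t ^+ 2 * (X + Y) <= t ^+ 2 * M by rewrite ler_wpM2l ?sqr_ge0 //; lra.
have tdel : 0 < t * del by rewrite mulr_gt0.
have tM0 : 0 <= t * M by rewrite mulr_ge0 // ltW.
have t1 : t <= 1 by nra.
have tM : 2 * (t * M) < del by lra.
have ttM : t ^+ 2 * M <= t * M by rewrite expr2 -mulrA ler_piMl.
(* With a gap, the bound is 1 - del + tM + t^2 M <= 1 - del + 2tM < 1. Otherwise it is 1 - 2t del +
   t^2 M < 1 - t del. *)
case/orP: hdel => [gap_ge|speed_ge].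
  have : t * (2 * dotp (x *m W) p) <= t * M by rewrite ler_pM2l //; lra.
  lra.
have : t * dotp (x *m W) p <= t * - del by rewrite ler_pM2l //; lra.
have : t * (t * M) < t * del by rewrite ltr_pM2l //; lra.
lra.
Qed.
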